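(* Let $G$ be a connected graph, let $\mathcal{P}=\{F_1,\dots,F_t\}$ be any partition of $E(G)$ into $t$ classes, let $A$ be the cycle–class parity matrix of $\mathcal{P}$ with respect to a fixed cycle basis of $G$, and let $\rho=\mathrm{rank}_{\mathbb{F}_2}(A)$. Then: (i) the most generic consistent assignment of generators to classes has dimension $k=t-\rho$: it is given by $g_j=\pi(e_j)$, the images of the standard basis vectors of $\mathbb{Z}_2^t$ under the quotient map $\pi:\mathbb{Z}_2^t\to\mathbb{Z}_2^t/\mathrm{rowspan}(A)\cong\mathbb{Z}_2^k$, and every other consistent assignment is a linear image of it; (ii) the breadth-first-search labeling $\lambda$ under this assignment is conflict-free by construction; (iii) with $S=\{g_j: g_j\neq\mathbf{0}\}$, every path of length $\ell$ in $G$ maps under $\lambda$ to a walk of length $\ell$ in $\mathrm{Cay}(\mathbb{Z}_2^k,S)$; hence $d_{\mathrm{Cay}}(\lambda(u),\lambda(v))\leq d_G(u,v)$ for all $u,v\in V(G)$, so the only possible failure of isometry is a shortcut (a pair with $d_{\mathrm{Cay}}(\lambda(u),\lambda(v))<d_G(u,v)$), never a stretch (a pair with $d_{\mathrm{Cay}}(\lambda(u),\lambda(v))>d_G(u,v)$).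
   Context: Graphs are finite, simple, connected and undirected, with $n$ vertices and $m$ edges; $d_G$ is the shortest-path distance. $\mathrm{class}(e)=j$ means $e\in F_j$. An assignment $g_1,\dots,g_t\in\mathbb{Z}_2^{k'}$ of generators to the classes is consistent if $\sum_{e\in C}g_{\mathrm{class}(e)}=\mathbf{0}$ for every cycle $C$ of $G$; a consistent assignment $(g'_1,\dots,g'_t)$ in $\mathbb{Z}_2^{k'}$ is a linear image of $(g_1,\dots,g_t)$ in $\mathbb{Z}_2^k$ if there is a linear map $L:\mathbb{Z}_2^k\to\mathbb{Z}_2^{k'}$ with $g'_j=L(g_j)$ for all $j$. The labeling induced by an assignment is $\lambda(v)=\sum_{e\in P(r,v)}g_{\mathrm{class}(e)}$, where $P(r,v)$ is a path from a fixed root $r$ to $v$; it is conflict-free (well defined) if it does not depend on the choice of $P(r,v)$. For a cycle basis $B_1,\dots,B_c$ of $G$ ($c=m-n+1$), the cycle–class parity matrix $A\in\mathbb{F}_2^{c\times t}$ is $A[i,j]=|F_j\cap E(B_i)|\bmod 2$. $\mathrm{Cay}(\mathbb{Z}_2^k,S)$ is the graph on $\mathbb{Z}_2^k$ with edges $\{g,g+s\}$, $s\in S$; $d_{\mathrm{Cay}}$ is its shortest-path distance.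
   Formalization: As edges whose class has generator 0 do not move the label and S excludes 0, a path of length ℓ is shown to map to ℓ steps that are Cayley edges or stationary, and to a genuine walk of length ℓ in Cay when no edge of the path has generator 0. *)

(* Defs.v *)
From HB Require Import structures.
From mathcomp Require Import all_boot all_order all_algebra.

Set Implicit Arguments.
Unset Strict Implicit.
Unset Printing Implicit Defensive.

Import GRing.Theory.

Local Open Scope ring_scope.
Local Open Scope quotient_scope.

(* A simple graph is a symmetric irreflexive [e : rel V]; its edges are the
   two-element sets {x, y} with [e x y]. A path or walk x, p_1, ..., p_l is
   given, as in [path], by its first vertex [x] and the sequence [p]; its
   length is [size p]. *)

Section Graphs.
Variables (V : finType) (e : rel V).

Definition edges : {set {set V}} := [set [set p.1; p.2] | p : V * V & e p.1 p.2].

Definition gpath (x : V) (p : seq V) : bool := path e x p && uniq (x :: p).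

Definition path_edges (x : V) (p : seq V) : seq {set V} :=
  pairmap (fun u v => [set u; v]) x p.

Definition walk (l : nat) (x : V) (p : seq V) : Prop :=
  size p = l /\ path e x p.

(* A walk that may also stand still at some steps; such steps count in [l]. *)
Definition lazy_walk (l : nat) (x : V) (p : seq V) : Prop :=
  size p = l /\ path [rel a b | (a == b) || e a b] x p.

(* The least length of a walk from [x] to [y]. A shortest walk has length
   < #|V|, and the value is #|V| when [y] is not reachable from [x]. *)
Definition dist (x y : V) : nat :=
  find (fun n => [exists p : n.-tuple V, path e x p && (last x p == y)])
       (iota 0 #|V|).

Definition gcycle (p : seq V) : bool := (2 < size p)%N && ucycleb e p.

Definition cycle_edges (p : seq V) : {set {set V}} :=
  [set [set x; next p x] | x in p].

Definition cycles : {set {set {set V}}} :=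
  [set C | [exists n : 'I_#|V|.+1, [exists p : n.-tuple V,
             gcycle p && (C == cycle_edges p)]]].

Definition edge_vec (C : {set {set V}}) : {ffun {set V} -> ('F_2)^o} :=
  [ffun ed => (ed \in C)%:R].

Definition cycle_space : {vspace {ffun {set V} -> ('F_2)^o}} :=
  <<[seq edge_vec C | C <- enum cycles]>>%VS.

(* The number [c] of cycles is not imposed: being a basis forces
   c = m - n + 1 when the graph is connected. *)
Definition cycle_basis (c : nat) (B : 'I_c -> seq V) : Prop :=
  (forall i, gcycle (B i)) /\
  basis_of cycle_space [seq edge_vec (cycle_edges (B i)) | i <- enum 'I_c].

(* [P v] is the path from the root [r] to [v] in a breadth-first-search tree:
   each [v != r] is reached from a neighbour one step closer to [r]. *)
Definition bfs_paths (r : V) (P : V -> seq V) : Prop :=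
  P r = [::] /\
  forall v, v != r ->
    exists u, [/\ e u v, dist r v = (dist r u).+1 & P v = rcons (P u) v].

Definition edge_partition (t : nat) (F : 'I_t -> {set {set V}}) : Prop :=
  injective F /\ partition [set F j | j : 'I_t] edges.

End Graphs.

Section Assignments.
Variables (V : finType) (e : rel V) (t : nat) (F : 'I_t -> {set {set V}}).

Definition class (ed : {set V}) : option 'I_t := [pick j | ed \in F j].

Definition edge_gen (k : nat) (g : 'I_t -> 'rV['F_2]_k) (ed : {set V}) :
    'rV['F_2]_k :=
  oapp g 0 (class ed).

Definition consistent (k : nat) (g : 'I_t -> 'rV['F_2]_k) : Prop :=
  forall p : seq V, gcycle e p -> \sum_(ed in cycle_edges p) edge_gen g ed = 0.

Definition linear_image (k k' : nat)
    (g : 'I_t -> 'rV['F_2]_k) (g' : 'I_t -> 'rV['F_2]_k') : Prop :=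
  exists L : {linear 'rV['F_2]_k -> 'rV['F_2]_k'}, forall j, g' j = L (g j).

Definition most_generic (k : nat) (g : 'I_t -> 'rV['F_2]_k) : Prop :=
  consistent g /\
  forall (k' : nat) (g' : 'I_t -> 'rV['F_2]_k'), consistent g' -> linear_image g g'.

(* The dimension of the span of the generators. *)
Definition assignment_dim (k : nat) (g : 'I_t -> 'rV['F_2]_k) : nat :=
  \rank (\matrix_j g j).

Definition path_sum (k : nat) (g : 'I_t -> 'rV['F_2]_k) (x : V) (p : seq V) :
    'rV['F_2]_k :=
  \sum_(ed <- path_edges x p) edge_gen g ed.

(* [P v] lists the path P(r,v) from the root [r] to [v]. *)
Definition labeling (k : nat) (g : 'I_t -> 'rV['F_2]_k) (r : V)
    (P : V -> seq V) (v : V) : 'rV['F_2]_k :=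
  path_sum g r (P v).

Definition conflict_free (k : nat) (g : 'I_t -> 'rV['F_2]_k) (r : V) : Prop :=
  forall (v : V) (p q : seq V),
    gpath e r p -> last r p = v -> gpath e r q -> last r q = v ->
    path_sum g r p = path_sum g r q.

Definition parity_matrix (c : nat) (B : 'I_c -> seq V) : 'M['F_2]_(c, t) :=
  \matrix_(i, j) (#|F j :&: cycle_edges (B i)|)%:R.

Definition gen_set (k : nat) (g : 'I_t -> 'rV['F_2]_k) : {set 'rV['F_2]_k} :=
  [set g j | j : 'I_t & g j != 0].

End Assignments.

(* Symmetric, since s = - s. *)
Definition cay (k : nat) (S : {set 'rV['F_2]_k}) : rel 'rV['F_2]_k :=
  [rel x y | [exists s in S, y == x + s]].

Definition rowspan (K : fieldType) (m n : nat) (A : 'M[K]_(m, n)) :=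
  fun v : 'rV[K]_n => (v <= A)%MS.

Lemma rowspan_zmod_closed (K : fieldType) (m n : nat) (A : 'M[K]_(m, n)) :
  zmod_closed (rowspan A).
Proof.
split=> [|u v uA vA]; first exact: sub0mx.
by rewrite unfold_in /rowspan addmx_sub ?eqmx_opp.
Qed.

Definition rowspan_zmod (K : fieldType) (m n : nat) (A : 'M[K]_(m, n)) :
    zmodClosed 'rV[K]_n :=
  HB.pack (rowspan A)
    (GRing.isZmodClosed.Build 'rV[K]_n (rowspan A) (rowspan_zmod_closed A)).

(* The quotient K^n / rowspan(A): the library's quotient of additive groups,
   made below into a vector space with the induced scaling. *)
Notation row_quot A := (Quotient.quot (rowspan_zmod A)).

Section RowQuotient.
Variables (K : fieldType) (m n : nat) (A : 'M[K]_(m, n)).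
Local Notation Q := (row_quot A).

Definition row_quot_scale (a : K) (x : Q) : Q := \pi_Q (a *: repr x).

Lemma row_quot_scaleE (a : K) (v : 'rV[K]_n) :
  row_quot_scale a (\pi_Q v) = \pi_Q (a *: v).
Proof.
apply/eqP; rewrite -Quotient.idealrBE -scalerBr.
apply: scalemx_sub; change (repr (\pi_Q v) - v \in rowspan_zmod A).
by rewrite Quotient.idealrBE reprK.
Qed.

Lemma row_quot_scaleA a b x :
  row_quot_scale a (row_quot_scale b x) = row_quot_scale (a * b) x.
Proof. by elim/quotW: x => v; rewrite (row_quot_scaleE b v) !row_quot_scaleE scalerA. Qed.

Lemma row_quot_scale1 : left_id 1 row_quot_scale.
Proof. by elim/quotW=> v; rewrite row_quot_scaleE scale1r. Qed.

Lemma row_quot_scaleDr : right_distributive row_quot_scale +%R.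
Proof.
move=> a; elim/quotW=> u; elim/quotW=> v.
by rewrite -raddfD !row_quot_scaleE scalerDr raddfD.
Qed.

Lemma row_quot_scaleDl x : {morph row_quot_scale^~ x : a b / a + b}.
Proof.
by elim/quotW: x => v a b; rewrite !row_quot_scaleE scalerDl raddfD.
Qed.

HB.instance Definition _ := GRing.Zmodule_isLmodule.Build K Q
  row_quot_scaleA row_quot_scale1 row_quot_scaleDr row_quot_scaleDl.

End RowQuotient.

(* Main.v *)
Require Import Defs.
From HB Require Import structures.
From mathcomp Require Import all_boot all_order all_algebra.

Set Implicit Arguments.
Unset Strict Implicit.
Unset Printing Implicit Defensive.

Import GRing.Theory.
Local Open Scope ring_scope.
Local Open Scope quotient_scope.

(* An assignment g extends to a linear map on edge vectors, so its vanishing on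
   all cycles can be tested on the cycle basis, where it reads A *m G = 0, G being
   the matrix with rows g_j. For an isomorphism phi of the quotient, the matrix M
   of phi o pi has full rank and left kernel rowspan(A), so every G with
   A *m G = 0 factors through M. Consistency makes the sum over every closed walk
   vanish, hence the label of v differs from that of a neighbour u by the generator
   of the class of {u, v}, and walks of G map to lazy walks of the Cayley graph. *)

Lemma rowF2_addrr (k : nat) (v : 'rV['F_2]_k) : v + v = 0.
Proof. by rewrite -mulr2n -scaler_nat (_ : 2%:R = 0) ?scale0r //; apply: val_inj. Qed.

Lemma rowF2_eq_of_add (k : nat) (u v : 'rV['F_2]_k) : u + v = 0 -> u = v.
Proof. by move=> uv0; rewrite -[u]addr0 -(rowF2_addrr v) addrA uv0 add0r. Qed.

(** * Shortest-path distance and removal of idle steps *)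

Section Distance.
Variables (V : finType) (e : rel V).

Lemma dist_le_size (x : V) (p : seq V) : path e x p -> (dist e x (last x p) <= size p)%N.
Proof.
move=> ep; have [ltpV | leVp] := ltnP (size p) #|V|; last first.
  (* A long walk needs no argument: [find] never exceeds the length [#|V|] of the searched list. *)
  by apply: leq_trans leVp; rewrite -[X in (_ <= X)%N](size_iota 0) find_size.
rewrite leqNgt; apply/negP => /(before_find 0%N).
rewrite nth_iota // add0n => /negbT /negP[]; apply/existsP.
by exists (in_tuple p); rewrite ep eqxx.
Qed.

Lemma dist_path (x y : V) :
  connect e x y -> exists2 p, path e x p /\ last x p = y & size p = dist e x y.
Proof.
(* A walk without repeated vertices has length below [#|V|], so the search in [dist] succeeds. *)
move=> /connectP[p0 /shortenP[p ep Up _] ->].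
set a := fun n : nat => [exists q : n.-tuple V, path e x q && (last x q == last x p)].
have ha : has a (iota 0 #|V|).
  apply/hasP; exists (size p); last by apply/existsP; exists (in_tuple p); rewrite ep eqxx.
  by rewrite mem_iota add0n -[(size p).+1]/(size (x :: p)) -(card_uniqP Up) max_card.
have := nth_find 0%N ha; rewrite nth_iota ?add0n; last first.
  by rewrite has_find size_iota in ha.
move=> /existsP[q /andP[eq /eqP lq]]; exists q => //.
by rewrite size_tuple.
Qed.

Lemma lazy_path_shortening (x : V) (p : seq V) :
  path [rel a b | (a == b) || e a b] x p ->
  exists q, [/\ path e x q, last x q = last x p & (size q <= size p)%N].
Proof.
elim: p x => [|y p IHp] x /=; first by exists [::].
case/andP=> /orP[/eqP-> | exy] /IHp[q [eq lq sq]].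
  by exists q; split=> //; apply: leqW.
by exists (y :: q); rewrite /= exy.
Qed.

End Distance.

(** * Edges of cycles and splitting at a repeated vertex *)

Section Cycles.
Variables (V : finType) (e : rel V).

Lemma cycle_edges_in_cycles (p : seq V) : gcycle e p -> cycle_edges p \in cycles e.
Proof.
move=> cp; rewrite inE; case/andP: (cp) => _ /andP[_ Up].
have lepV : (size p < #|V|.+1)%N by rewrite ltnS -(card_uniqP Up) max_card.
by apply/existsP; exists (Ordinal lepV); apply/existsP; exists (in_tuple p); rewrite cp eqxx.
Qed.

(** Two vertices giving the same edge would be each other's successor, which happens only on a cycle
    of length 2. Sums over the edge set of a cycle thus become sums over its vertices. *)
Lemma next_edge_inj (p : seq V) :
  uniq p -> (2 < size p)%N -> {in p &, injective (fun x => [set x; next p x])}.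
Proof.
move=> Up szp x y xp yp /setP exy; apply: contraTeq isT => neq_xy.
have := exy x; have := exy y; rewrite !inE !eqxx /= [y == x]eq_sym (negPf neq_xy) /=.
move=> /eqP nx /esym /eqP ny; case: (rot_to xp) => i s rps.
have Us : uniq (x :: s) by rewrite -rps rot_uniq.
move: nx ny; rewrite -(next_rot i Up x) -(next_rot i Up y) rps.
have : (2 < size (x :: s))%N by rewrite -rps size_rot.
case: s Us {rps} => [|y1 [|z s]] //= /and4P[]; rewrite !inE !negb_or.
move=> /and3P[_ nxz _] _ _ _ _; rewrite eqxx => <-.
by rewrite [y == x]eq_sym (negPf neq_xy) eqxx => xz; rewrite xz eqxx in nxz.
Qed.

Lemma next_edges_path_edges (x : V) (p : seq V) :
  uniq (x :: p) ->
  [seq [set y; next (x :: p) y] | y <- x :: p] = path_edges x (rcons p x).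
Proof.
move=> Up; apply: (@eq_from_nth _ set0); first by rewrite size_map size_pairmap size_rcons.
move=> i; rewrite size_map => lti.
rewrite (nth_map x) // (nth_pairmap x) ?size_rcons // next_nth mem_nth // index_uniq //.
rewrite nth_rcons; congr [set _; _].
  by rewrite -rcons_cons nth_rcons lti.
(* At the last index the default [x] of [nth] agrees with the closing vertex added by [rcons]. *)
have [//|lepi] := ltnP i (size p); last by rewrite nth_default // if_same.
Qed.

End Cycles.

Lemma repeated_vertex_split (T : eqType) (x : T) (p : seq T) :
  ~~ uniq (x :: p) ->
  exists p1 p2 p3,
    [/\ p = p1 ++ p2 ++ p3, p2 != [::] & last (last x p1) p2 = last x p1].
Proof.
elim: p x => [|y p IHp] x //; rewrite cons_uniq negb_and negbK.
case/orP=> [/path.splitP[s1 s2] | /IHp[p1 [p2 [p3 [-> nz lp]]]]].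
  by exists [::], (rcons s1 x), s2; rewrite last_rcons; split=> //; case: s1.
by exists (y :: p1), p2, p3.
Qed.

(** * Sums of generators along walks *)

Section PathSums.
Variables (V : finType) (e : rel V) (t : nat) (F : 'I_t -> {set {set V}}).
Variables (k : nat) (g : 'I_t -> 'rV['F_2]_k).
Hypotheses (e_sym : symmetric e) (e_irr : irreflexive e).

Lemma path_sum_cons (x y : V) (p : seq V) :
  path_sum F g x (y :: p) = edge_gen F g [set x; y] + path_sum F g y p.
Proof. by rewrite /path_sum /path_edges /= big_cons. Qed.

Lemma path_sum_cat (x : V) (p q : seq V) :
  path_sum F g x (p ++ q) = path_sum F g x p + path_sum F g (last x p) q.
Proof. by rewrite /path_sum /path_edges pairmap_cat big_cat. Qed.

Lemma path_sum_rev (x : V) (p : seq V) :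
  path_sum F g (last x p) (rev (belast x p)) = path_sum F g x p.
Proof.
elim: p x => [|y p IHp] x //=.
rewrite rev_cons -cats1 path_sum_cat IHp [RHS]path_sum_cons [RHS]addrC; congr (_ + _).
rewrite path_sum_cons [path_sum _ _ _ [::]]big_nil addr0 setUC.
by case: p {IHp} => [|z p] //=; rewrite rev_cons last_rcons.
Qed.

Hypothesis g_cons : consistent e F g.

(* A closed walk either repeats an inner vertex, and then splits there into two
   shorter closed walks, or is a cycle or the doubling of one edge. *)
Lemma closed_path_sum (x : V) (p : seq V) :
  path e x p -> last x p = x -> path_sum F g x p = 0.
Proof.
have [n] := ubnP (size p); elim: n x p => // n IHn x p ltpn.
case/lastP: p ltpn => [|p z]; first by rewrite /path_sum big_nil.
rewrite last_rcons size_rcons ltnS => ltpn ep zx; rewrite {z}zx in ep *.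
have [Up | nUp] := boolP (uniq (x :: p)).
  have [sz|] := ltnP 2 (size (x :: p)).
    have cp : gcycle e (x :: p) by rewrite /gcycle sz /ucycleb /= ep.
    have := g_cons cp; rewrite big_imset /=; last exact: next_edge_inj.
    by rewrite /path_sum -next_edges_path_edges // big_map (big_uniq _ Up).
  case: p ep {Up ltpn} => [|y [|//]] /=; first by rewrite e_irr.
  by rewrite !path_sum_cons [path_sum _ _ _ [::]]big_nil addr0 setUC rowF2_addrr.
have [p1 [p2 [p3 [def_p nz_p2 lp2]]]] := repeated_vertex_split nUp.
have def_px : rcons p x = p1 ++ p2 ++ rcons p3 x by rewrite def_p !rcons_cat.
move: ep; rewrite def_px !cat_path => /and3P[ep1 ep2 ep3].
rewrite lp2 in ep3; rewrite !path_sum_cat lp2.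
(* Both closed pieces are nonempty, one by [nz_p2] and the other by its final [x], so each is
   shorter than the whole. *)
have sz : (size p2 + size (p1 ++ rcons p3 x) = (size p).+1)%N.
  by rewrite -(size_rcons p x) def_px !size_cat addnCA.
rewrite (IHn (last x p1) p2) ?add0r //; last first.
  by apply: leq_ltn_trans ltpn; rewrite -ltnS -sz size_cat size_rcons !addnS ltnS leq_addr.
rewrite -path_sum_cat IHn ?last_cat ?last_rcons ?cat_path ?ep1 //.
by apply: leq_ltn_trans ltpn; rewrite -ltnS -sz -[ltnLHS]add0n ltn_add2r lt0n size_eq0.
Qed.

(** Following [p] and then [q] backwards is a closed walk, so the two sums add up to 0 and agree in
    characteristic 2. *)
Lemma walk_path_sum_eq (x : V) (p q : seq V) :
  path e x p -> path e x q -> last x p = last x q -> path_sum F g x p = path_sum F g x q.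
Proof.
move=> ep eq lpq; apply: rowF2_eq_of_add; rewrite -(path_sum_rev x q) -lpq -path_sum_cat.
apply: closed_path_sum; last first.
  by rewrite last_cat lpq; case: q {ep eq lpq} => //= y q; rewrite rev_cons last_rcons.
by rewrite cat_path ep lpq (eq_path (e' := fun u v => e v u)) ?rev_path //.
Qed.

(** [P u] extended by the edge to [v] may differ from [P v], but both walks end at [v] and hence
    have the same sum. *)
Lemma labeling_step (r u v : V) (P : V -> seq V) :
  (forall w, path e r (P w) /\ last r (P w) = w) -> e u v ->
  labeling F g r P v = labeling F g r P u + edge_gen F g [set u; v].
Proof.
move=> hP euv; have [ru lu] := hP u; have [rv lv] := hP v.
rewrite /labeling (@walk_path_sum_eq r (P v) (rcons (P u) v)) //.
- by rewrite -cats1 path_sum_cat lu path_sum_cons /path_sum big_nil addr0.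
- by rewrite rcons_path ru lu.
- by rewrite last_rcons.
Qed.

End PathSums.

Lemma bfs_paths_walk (V : finType) (e : rel V) (r : V) (P : V -> seq V) :
  bfs_paths e r P -> forall v, path e r (P v) /\ last r (P v) = v.
Proof.
move=> [Pr Pstep] v; have [n] := ubnP (dist e r v); elim: n v => // n IHn v ltvn.
have [-> | /Pstep[u [euv dv ->]]] := eqVneq v r; first by rewrite Pr.
have [ru lu] := IHn u (leq_trans (eq_leq (esym dv)) ltvn).
by rewrite rcons_path ru lu last_rcons.
Qed.

(** * Images of walks in the Cayley graph *)

Section Labeling.
Variables (V : finType) (e : rel V) (t : nat) (F : 'I_t -> {set {set V}}).
Variables (k : nat) (g : 'I_t -> 'rV['F_2]_k).
Variable lam : V -> 'rV['F_2]_k.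
Hypothesis lam_step :
  forall u v, e u v -> lam v = lam u + edge_gen F g [set u; v].
Local Notation S := (gen_set g).

Lemma cay_labeling (u v : V) :
  e u v -> edge_gen F g [set u; v] != 0 -> cay S (lam u) (lam v).
Proof.
move=> /lam_step-> nz; apply/existsP; exists (edge_gen F g [set u; v]).
rewrite eqxx andbT; move: nz; rewrite /edge_gen; case: class => [j|] /= nz.
  by apply: imset_f; rewrite inE.
by rewrite eqxx in nz.
Qed.

Lemma lazy_walk_labeling (x : V) (p : seq V) :
  path e x p -> lazy_walk (cay S) (size p) (lam x) [seq lam v | v <- p].
Proof.
move=> ep; split; first by rewrite size_map.
elim: p x ep => //= y p IHp x /andP[exy /IHp->]; rewrite andbT.
(* A zero generator leaves the label unchanged and is not in [S]: here the image walk stands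
   still. *)
have [g0 | nz] := eqVneq (edge_gen F g [set x; y]) 0.
  by rewrite (lam_step exy) g0 addr0 eqxx.
by rewrite cay_labeling ?orbT.
Qed.

Lemma walk_labeling (x : V) (p : seq V) :
  path e x p -> (forall ed, ed \in path_edges x p -> edge_gen F g ed != 0) ->
  walk (cay S) (size p) (lam x) [seq lam v | v <- p].
Proof.
move=> ep nz; split; first by rewrite size_map.
elim: p x ep nz => //= y p IHp x /andP[exy ep] nz.
rewrite cay_labeling ?nz ?inE ?eqxx //=.
by apply: IHp => // ed edp; apply: nz; rewrite inE edp orbT.
Qed.

Lemma dist_cay_labeling (u v : V) :
  connect e u v -> (dist (cay S) (lam u) (lam v) <= dist e u v)%N.
Proof.
move=> /dist_path[p [ep <-] <-].
have [_ /lazy_path_shortening[q [eq lq sq]]] := lazy_walk_labeling ep.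
rewrite last_map in lq; rewrite size_map in sq.
by apply: leq_trans sq; rewrite -lq dist_le_size.
Qed.

End Labeling.

(** * Consistency as a linear system *)

Section Consistency.
Variables (V : finType) (e : rel V) (t : nat) (F : 'I_t -> {set {set V}}).
Hypothesis hF : edge_partition e F.

(** The classes are disjoint, so at most one coefficient is nonzero. *)
Lemma edge_genE (k : nat) (g : 'I_t -> 'rV['F_2]_k) (ed : {set V}) :
  edge_gen F g ed = \sum_j (ed \in F j)%:R *: g j.
Proof.
rewrite /edge_gen /class; case: pickP => [j edj | no_ed] /=; last first.
  by rewrite big1 // => j _; rewrite no_ed scale0r.
rewrite (bigD1 j) //= edj scale1r big1 ?addr0 // => i neq_ij.
case: (boolP (ed \in F i)) => [edi | _]; last by rewrite scale0r.
have [Finj /and3P[_ /trivIsetP tF _]] := hF.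
have /tF dij : F i \in [set F j | j : 'I_t] by apply: imset_f.
have /dij : F j \in [set F j | j : 'I_t] by apply: imset_f.
rewrite (inj_eq Finj) => /(_ neq_ij) /pred0P/(_ ed).
by rewrite /= edi edj.
Qed.

(** The linear extension of [edge_gen] from single edges to vectors, so that the cycles with sum 0
    are those whose vector lies in its kernel. *)
Definition edge_eval (k : nat) (g : 'I_t -> 'rV['F_2]_k)
    (w : {ffun {set V} -> ('F_2)^o}) : 'rV['F_2]_k :=
  \sum_ed (w ed : 'F_2) *: edge_gen F g ed.

Lemma edge_eval_is_linear (k : nat) (g : 'I_t -> 'rV['F_2]_k) : linear (edge_eval g).
Proof.
move=> a u v; rewrite /edge_eval scaler_sumr -big_split /=.
by apply: eq_bigr => ed _; rewrite !ffunE scalerDl scalerA.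
Qed.

HB.instance Definition _ (k : nat) (g : 'I_t -> 'rV['F_2]_k) :=
  GRing.isLinear.Build _ _ _ _ (edge_eval g) (edge_eval_is_linear g).

Lemma edge_eval_edge_vec (k : nat) (g : 'I_t -> 'rV['F_2]_k) (C : {set {set V}}) :
  edge_eval g (edge_vec C) = \sum_(ed in C) edge_gen F g ed.
Proof.
rewrite big_mkcond; apply: eq_bigr => ed _; rewrite ffunE.
by case: ifP => _; rewrite ?scale1r ?scale0r.
Qed.

Lemma edge_eval_cycle (k : nat) (g : 'I_t -> 'rV['F_2]_k)
    (c : nat) (B : 'I_c -> seq V) (i : 'I_c) :
  edge_eval g (edge_vec (cycle_edges (B i))) =
    row i (parity_matrix F B *m \matrix_j g j).
Proof.
rewrite edge_eval_edge_vec row_mul mulmx_sum_row.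
under eq_bigr do rewrite edge_genE.
(* Double counting: grouped by class, each [g j] occurs once per edge of the cycle in [F j]. *)
rewrite exchange_big /=; apply: eq_bigr => j _.
rewrite rowK !mxE -scaler_suml -natr_sum; congr (_%:R *: _).
rewrite -sum1_card big_mkcond [RHS]big_mkcond; apply: eq_bigr => ed _.
by rewrite inE; case: (ed \in F j); case: ifP.
Qed.

Lemma consistentE (k : nat) (g : 'I_t -> 'rV['F_2]_k)
    (c : nat) (B : 'I_c -> seq V) :
  cycle_basis e B -> consistent e F g <-> parity_matrix F B *m (\matrix_j g j) = 0.
Proof.
move=> [cB /andP[/eqP spanB _]]; split=> [g_cons | Ag0 p cp].
  apply/row_matrixP=> i; rewrite -edge_eval_cycle edge_eval_edge_vec row0.
  exact: g_cons.
rewrite -edge_eval_edge_vec -(lfunE (edge_eval g)); apply/eqP.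
rewrite -memv_ker; have: edge_vec (cycle_edges p) \in cycle_space e.
  by apply: memv_span; apply: map_f; rewrite mem_enum cycle_edges_in_cycles.
(* The kernel of [edge_eval g] is a subspace, so it contains the cycle space once it contains the
   basis. *)
rewrite -spanB; apply/subvP/span_subvP => _ /mapP[i _ ->].
by rewrite memv_ker lfunE /= edge_eval_cycle Ag0 row0.
Qed.

End Consistency.

(** * The quotient by the row span in coordinates *)

Section Generic.
Variables (K : fieldType) (m n : nat) (A : 'M[K]_(m, n)).

(* Factor [G] through [M] as [M *m (pinvmx M *m G)]: the rows of
   [M *m pinvmx M - 1] lie in the kernel of [M], hence are killed by [G]. *)
Lemma mulmx_factor (k k' : nat) (M : 'M[K]_(n, k)) (G : 'M[K]_(n, k')) :
  row_full M -> (kermx M <= A)%MS -> A *m G = 0 -> M *m (pinvmx M *m G) = G.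
Proof.
move=> fM kMA AG0; apply/eqP; rewrite -subr_eq0 mulmxA -{2}[G]mul1mx -mulmxBl.
have /submxP[D ->] : (M *m pinvmx M - 1%:M <= A)%MS.
  apply: submx_trans kMA; apply/sub_kermxP.
  by rewrite mulmxBl -mulmxA mulVpmx // mulmx1 mul1mx subrr.
by rewrite -mulmxA AG0 mulmx0.
Qed.

Lemma row_quot_eq0 (v : 'rV[K]_n) : (\pi_(row_quot A) v == 0) = (v <= A)%MS.
Proof.
by rewrite -[0](raddf0 (\pi_(row_quot A))) -Quotient.idealrBE subr0.
Qed.

Lemma pi_row_quotZ (a : K) (v : 'rV[K]_n) :
  \pi_(row_quot A) (a *: v) = a *: \pi_(row_quot A) v.
Proof. by rewrite -row_quot_scaleE. Qed.

Lemma row_quot_isomorphism :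
  exists phi : {linear row_quot A -> 'rV[K]_(n - \rank A)}, bijective phi.
Proof.
have [M [fM kM]] : exists M : 'M[K]_(n, n - \rank A),
    row_full M /\ forall v : 'rV_n, (v *m M == 0) = (v <= A)%MS.
  (* [cokermx A] has left kernel the row span of [A] and rank [n - \rank A]; a column base keeps
     this kernel and has full rank. *)
  rewrite -mxrank_coker; exists (col_base (cokermx A)); split=> [|v].
    exact: col_base_full.
  by rewrite submxE -[in RHS](mulmx_base (cokermx A)) mulmxA [RHS]mulmx_free_eq0 ?row_base_free.
(* Two representatives differ by an element of the row span, which [M] kills. *)
have repr_mulM (x : row_quot A) v : x = \pi_(row_quot A) v -> repr x *m M = v *m M.
  move=> xv; apply/eqP; rewrite -subr_eq0 -mulmxBl kM -row_quot_eq0 raddfB /= reprK xv.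
  by rewrite subrr.
pose f (x : row_quot A) := repr x *m M.
have lin_f : linear f.
  move=> a x y; rewrite /f -[RHS]/(a *: _ + _) scalemxAl -mulmxDl; apply: repr_mulM.
  by rewrite raddfD /= pi_row_quotZ !reprK.
exists (HB.pack_for {linear row_quot A -> 'rV[K]_(n - \rank A)} f
  (GRing.isLinear.Build _ _ _ _ f lin_f)).
exists (fun w => \pi_(row_quot A) (w *m pinvmx M)) => [x | w] /=.
  apply/eqP; rewrite -{2}[x]reprK -subr_eq0 -raddfB row_quot_eq0 -kM mulmxBl.
  by rewrite -mulmxA mulVpmx // mulmx1 subrr.
by rewrite /f (repr_mulM _ _ erefl) -mulmxA mulVpmx // mulmx1.
Qed.

(** [M] is the matrix of [phi] after the projection: surjectivity gives full rank, injectivity the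
    kernel. *)
Lemma row_quot_matrix (k : nat) (phi : {linear row_quot A -> 'rV[K]_k}) :
  bijective phi ->
  let M := \matrix_j phi (\pi_(row_quot A) (delta_mx 0 j)) in
  row_full M /\ forall v : 'rV_n, (v *m M == 0) = (v <= A)%MS.
Proof.
move=> bij_phi M.
have mulM (v : 'rV_n) : v *m M = phi (\pi_(row_quot A) v).
  rewrite mulmx_sum_row [in RHS](row_sum_delta v) !raddf_sum /=.
  by apply: eq_bigr => j _; rewrite rowK pi_row_quotZ linearZ.
split=> [|v]; last by rewrite mulM -row_quot_eq0 (raddf_eq0 _ (bij_inj bij_phi)).
rewrite -sub1mx; apply/row_subP=> i; have [psi _ psiK] := bij_phi.
apply/submxP; exists (repr (psi (row i 1%:M))).
by rewrite mulM reprK psiK.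
Qed.

End Generic.

(** * Universality of the quotient assignment and its dimension *)

Section MostGeneric.
Variables (V : finType) (e : rel V) (t : nat) (F : 'I_t -> {set {set V}}).

Lemma linear_image_dim (k k' : nat) (g : 'I_t -> 'rV['F_2]_k) (g' : 'I_t -> 'rV['F_2]_k') :
  linear_image g g' -> (assignment_dim g' <= assignment_dim g)%N.
Proof.
move=> [L gL]; rewrite /assignment_dim.
have -> : \matrix_j g' j = (\matrix_j g j) *m lin1_mx L.
  by apply/row_matrixP=> j; rewrite row_mul !rowK mul_rV_lin1.
exact: mxrankM_maxl.
Qed.

Lemma most_generic_dim (k k' : nat) (g : 'I_t -> 'rV['F_2]_k) (g' : 'I_t -> 'rV['F_2]_k') :
  most_generic e F g -> most_generic e F g' -> assignment_dim g' = assignment_dim g.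
Proof.
move=> [cg gen_g] [cg' gen_g'].
apply/eqP; rewrite eqn_leq (linear_image_dim (gen_g _ _ cg')).
by rewrite (linear_image_dim (gen_g' _ _ cg)).
Qed.

Lemma most_generic_quotient (c : nat) (B : 'I_c -> seq V) (k : nat)
    (phi : {linear row_quot (parity_matrix F B) -> 'rV['F_2]_k}) :
  edge_partition e F -> cycle_basis e B -> bijective phi ->
  let g := fun j : 'I_t => phi (\pi_(row_quot (parity_matrix F B)) (delta_mx 0 j)) in
  most_generic e F g /\ assignment_dim g = k.
Proof.
move=> hF hB bij_phi g; set A := parity_matrix F B in phi bij_phi g *.
have [fM kM] := row_quot_matrix bij_phi.
set M := \matrix_j _ in fM kM.
(* The rows of [M] are the generators, so [row_full M] says that they span dimension [k]. *)
split; last exact/eqP.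
split=> [|k' g' /(consistentE hF _ hB) AG0].
  apply/(consistentE hF _ hB)/row_matrixP=> i; rewrite row_mul row0.
  by apply/eqP; rewrite kM row_sub.
have kMA : (kermx M <= A)%MS.
  by apply/row_subP=> i; rewrite -kM -row_mul mulmx_ker row0.
(* The linear map is the second factor in [mulmx_factor]. *)
exists (mulmxr (pinvmx M *m \matrix_j g' j)) => j /=.
by rewrite -[LHS](rowK g' j) -[in LHS](mulmx_factor fM kMA AG0) row_mul rowK.
Qed.

End MostGeneric.

Theorem theorem2p25 (V : finType) (e : rel V)
  (e_sym : symmetric e) (e_irr : irreflexive e)
  (e_conn : forall x y : V, connect e x y)
  (t : nat) (F : 'I_t -> {set {set V}}) (hF : edge_partition e F)
  (c : nat) (B : 'I_c -> seq V) (hB : cycle_basis e B)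
  (r : V) (P : V -> seq V) (hP : bfs_paths e r P) :
  let A := parity_matrix F B in
  let k := (t - \rank A)%N in
  (forall (k' : nat) (g' : 'I_t -> 'rV['F_2]_k'),
      most_generic e F g' -> assignment_dim g' = k) /\
  (exists phi : {linear row_quot A -> 'rV['F_2]_k}, bijective phi) /\
  (forall phi : {linear row_quot A -> 'rV['F_2]_k}, bijective phi ->
     let g := fun j : 'I_t => phi (\pi_(row_quot A) (delta_mx 0 j)) in
     let S := gen_set g in
     let lam := labeling F g r P in
     let dCay := dist (cay S) in
     let dG := dist e in
     (* (i) *)
     (most_generic e F g /\ assignment_dim g = k) /\
     (* (ii) *)
     conflict_free e F g r /\
     (* (iii) *)
     [/\ forall (l : nat) (x : V) (p : seq V), gpath e x p -> size p = l ->
           lazy_walk (cay S) l (lam x) [seq lam v | v <- p] /\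
           ((forall ed, ed \in path_edges x p -> edge_gen F g ed != 0) ->
            walk (cay S) l (lam x) [seq lam v | v <- p]),
         forall u v : V, (dCay (lam u) (lam v) <= dG u v)%N,
         forall u v : V, dCay (lam u) (lam v) <> dG u v ->
           (dCay (lam u) (lam v) < dG u v)%N &
         ~ exists u v : V, (dCay (lam u) (lam v) > dG u v)%N]).
Proof.
move=> A k.
have [phi0 bij0] := row_quot_isomorphism A.
have [gen0 dim0] := most_generic_quotient hF hB bij0.
(* Most generic assignments are linear images of each other, so the one from [phi0] fixes the
   dimension of all. *)
split=> [k' g' gen'|]; first by rewrite (most_generic_dim gen0 gen').
split=> [|phi bij_phi g S lam dCay dG]; first by exists phi0.
have [gen_g dim_g] := most_generic_quotient hF hB bij_phi.
have g_cons : consistent e F g := gen_g.1.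
have lam_step u v : e u v -> lam v = lam u + edge_gen F g [set u; v].
  exact: labeling_step (bfs_paths_walk hP).
have dist_le u v : (dCay (lam u) (lam v) <= dG u v)%N
  := dist_cay_labeling lam_step (e_conn u v).
split=> //; split.
  move=> v p q /andP[ep _] lp /andP[eq _] lq.
  by apply: walk_path_sum_eq => //; rewrite lp lq.
split=> // [l x p /andP[ep _] <- | u v /eqP neq_uv | [u [v]]].
- by split=> [|nz]; [apply: (lazy_walk_labeling lam_step) | apply: (walk_labeling lam_step)].
- by rewrite ltn_neqAle neq_uv dist_le.
- by rewrite ltnNge dist_le.
Qed.
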